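(* Let $n$ be a positive integer and let $\widetilde{T}_n\in\mathcal{R}_n$ act like the $n$-th Hecke operator on periods, i.e. there is $Y\in\mathcal{R}_n$ with $(1-S)\widetilde{T}_n=T_n^\infty(1-S)+(1-T)Y$. Suppose that $\widetilde{T}_n=\sum_{\gamma}v_\gamma\gamma$ (a finite sum with $v_\gamma\in\mathbb{Q}$), where the $\gamma=\begin{bmatrix}a&b\\c&d\end{bmatrix}$ are matrices with non-negative entries. Let $s\in\mathbb{C}$ with $\Re(s)>0$ and $\psi_s^-(x)=1-x^{-2s}$. Then for all $x>0$, $$\big(\psi_s^-|_{2s}\widetilde{T}_n\big)(x)=n^{s}\sigma_{1-2s}(n)\,\psi_s^-(x).$$
   Context: For a positive integer $n$, $\mathcal{M}_n$ is the set of $2\times2$ integer matrices of determinant $n$ modulo $\{\pm1\}$, $\mathcal{M}=\bigcup_{n\ge 1}\mathcal{M}_n$, $\mathcal{R}_n=\mathbb{Q}[\mathcal{M}_n]$ (finite formal $\mathbb{Q}$-linear combinations), and $\mathcal{R}=\mathbb{Q}[\mathcal{M}]=\bigoplus_n\mathcal{R}_n$ is the ring with multiplication induced by matrix multiplication, $1$ being the class of the identity matrix. Put $T=\begin{bmatrix}1&1\\0&1\end{bmatrix}$, $S=\begin{bmatrix}0&-1\\1&0\end{bmatrix}$, and $T_n^\infty=\sum_{ad=n}\sum_{0\le b<d}\begin{bmatrix}a&b\\0&d\end{bmatrix}\in\mathcal{R}_n$ (sum over positive $a,d$ with $ad=n$). The slash operator of weight $m$ is $(f|_m\gamma)(x)=\frac{(ad-bc)^{m/2}}{(cx+d)^m}f\left(\frac{ax+b}{cx+d}\right)$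 for $\gamma=\begin{bmatrix}a&b\\c&d\end{bmatrix}$, extended linearly: $f|_m\sum_\gamma v_\gamma\gamma=\sum_\gamma v_\gamma\,f|_m\gamma$; here each $\gamma$ is represented by its matrix with non-negative entries, so for $x>0$ all of $ax+b$, $cx+d$ are positive, and complex powers of positive reals are taken with the real logarithm. The divisor function is $\sigma_w(n)=\sum_{\ell\mid n}\ell^w$. *)

(* Defs.v *)
From HB Require Import structures.
From mathcomp Require Import all_boot all_order all_algebra finmap.
From mathcomp.multinomials Require Import monalg.
From mathcomp Require Import complex.
From mathcomp Require Import reals.
From mathcomp.analysis Require Import sequences exp trigo.

Set Implicit Arguments.
Unset Strict Implicit.
Unset Printing Implicit Defensive.
Import Order.TTheory GRing.Theory Num.Theory.
Local Open Scope ring_scope.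
Local Open Scope quotient_scope.
Local Open Scope complex_scope.

Definition mx22 (K : Type) (a b c d : K) : 'M[K]_2 :=
  \matrix_(i < 2, j < 2)
    if i == 0 then (if j == 0 then a else b) else (if j == 0 then c else d).

Definition posmx := {A : 'M[int]_2 | 0 < \det A}.

Lemma detN2 (A : 'M[int]_2) : \det (- A) = \det A.
Proof. by rewrite -scaleN1r detZ sqrrN expr1n mul1r. Qed.

Definition pm_eq (A B : posmx) : bool :=
  (val A == val B) || (val A == - val B).

Lemma pm_eq_equiv : equiv_class_of pm_eq.
Proof.
rewrite /pm_eq; split=> [A|A B|B A C] /=; first by rewrite eqxx.
  by congr orb; [exact: eq_sym|rewrite eq_sym eqr_oppLR].
case/orP=> /eqP ->; first by [].
by rewrite eqr_opp eqr_oppLR orbC.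
Qed.

Canonical pm_eq_equivRel := EquivRelPack pm_eq_equiv.

(* Integer 2 x 2 matrices of positive determinant modulo {1, -1}: the union
   over n >= 1 of the sets M_n, with M_n the classes such that pmx_det = n. *)
Definition pmx := {eq_quot pm_eq}.
HB.instance Definition _ := Choice.on pmx.

Lemma posmx1_subproof : 0 < \det (1%:M : 'M[int]_2).
Proof. by rewrite det1. Qed.

Lemma posmxM_subproof (A B : posmx) : 0 < \det (val A *m val B).
Proof. by rewrite det_mulmx mulr_gt0 ?(valP A) ?(valP B). Qed.

Definition posmx1 : posmx := Sub 1%:M posmx1_subproof.
Definition posmxM (A B : posmx) : posmx := Sub (val A *m val B) (posmxM_subproof A B).

Definition pmx1 : pmx := \pi_pmx posmx1.
HB.lock Definition pmxM (g h : pmx) : pmx := \pi_pmx (posmxM (repr g) (repr h)).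
Definition pmx_det (g : pmx) : int := \det (val (repr g)).

Lemma pmx_eqP (A B : posmx) :
  reflect (val A = val B \/ val A = - val B) (\pi_pmx A == \pi_pmx B).
Proof.
apply: (iffP eqP) => [/eqmodP/orP[]/eqP ->|h]; [by left|by right|].
by apply/eqmodP/orP; case: h => ->; rewrite eqxx; [left|right].
Qed.

Lemma repr_pmx (A : posmx) :
  val (repr (\pi_pmx A)) = val A \/ val (repr (\pi_pmx A)) = - val A.
Proof. by apply/pmx_eqP; rewrite reprK. Qed.

Lemma pmxME (A B : posmx) : pmxM (\pi_pmx A) (\pi_pmx B) = \pi_pmx (posmxM A B).
Proof.
rewrite pmxM.unlock; apply/eqP/pmx_eqP => /=.
case: (repr_pmx A) (repr_pmx B) => -> [] ->; rewrite ?mulNmx ?mulmxN ?opprK;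
  by [left|right].
Qed.

Lemma pmx_detE (A : posmx) : pmx_det (\pi_pmx A) = \det (val A).
Proof. by rewrite /pmx_det; case: (repr_pmx A) => ->; rewrite ?detN2. Qed.

Lemma pmxMA : associative pmxM.
Proof.
elim/quotW=> A; elim/quotW=> B; elim/quotW=> C.
rewrite (pmxME B C) (pmxME A B) (pmxME A) (pmxME _ C).
by apply/eqP/pmx_eqP; left; rewrite /= mulmxA.
Qed.

Lemma pmx1M : left_id pmx1 pmxM.
Proof.
elim/quotW=> A; rewrite (pmxME posmx1 A).
by apply/eqP/pmx_eqP; left; rewrite /= mul1mx.
Qed.

Lemma pmxM1 : right_id pmx1 pmxM.
Proof.
elim/quotW=> A; rewrite (pmxME A posmx1).
by apply/eqP/pmx_eqP; left; rewrite /= mulmx1.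
Qed.

(* The ring structure of [monalg] on {malg G[K]} requires K to have no
   invertible element besides 1, which fails for [pmx]; only the module
   structure is reused, on an alias carrying the convolution product. *)
Definition hecke_ring := {malg rat[pmx]}.
HB.instance Definition _ := GRing.Lmodule.copy hecke_ring {malg rat[pmx]}.

HB.lock Definition heckeU (c : rat) (g : pmx) : hecke_ring := mkmalgU g c.
Definition hecke1 : hecke_ring := heckeU 1 pmx1.
HB.lock Definition heckeM (u v : hecke_ring) : hecke_ring :=
  \sum_(g <- msupp u) \sum_(h <- msupp v)
    heckeU (mcoeff g u * mcoeff h v) (pmxM g h).

Section HeckeRing.
Implicit Types (u v w : hecke_ring) (g h k : pmx).

Lemma heckeU0 g : heckeU 0 g = 0.
Proof. by rewrite heckeU.unlock; exact: monalgU0. Qed.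

Lemma heckeUD g : {morph heckeU^~ g : x y / x + y}.
Proof. by rewrite heckeU.unlock; exact: monalgUD. Qed.

Lemma heckeE u : u = \sum_(g <- msupp u) heckeU (mcoeff g u) g.
Proof. by rewrite heckeU.unlock; exact: monalgE. Qed.

Lemma heckeMw (d1 d2 : {fset pmx}) u v :
  (msupp u `<=` d1)%fset -> (msupp v `<=` d2)%fset ->
  heckeM u v = \sum_(g <- d1) \sum_(h <- d2)
    heckeU (mcoeff g u * mcoeff h v) (pmxM g h).
Proof.
move=> le1 le2; rewrite heckeM.unlock (big_fset_incl _ le1) /=.
  apply: eq_bigr => g _; apply: big_fset_incl => // h _ /mcoeff_outdom ->.
  by rewrite mulr0 heckeU0.
move=> g _ /mcoeff_outdom g0.
by rewrite big1 // => h _; rewrite g0 mul0r heckeU0.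
Qed.

Lemma heckeMDl : left_distributive heckeM +%R.
Proof.
move=> u1 u2 v.
rewrite (heckeMw (msuppD_le u1 u2) (fsubset_refl _)).
rewrite (heckeMw (fsubsetUl (msupp u1) (msupp u2)) (fsubset_refl (msupp v))).
rewrite (heckeMw (fsubsetUr (msupp u1) (msupp u2)) (fsubset_refl (msupp v))).
rewrite -big_split /=; apply: eq_bigr => g _.
rewrite -big_split /=; apply: eq_bigr => h _.
by rewrite [mcoeff g _]mcoeffD mulrDl heckeUD.
Qed.

Lemma heckeMDr : right_distributive heckeM +%R.
Proof.
move=> v u1 u2.
rewrite (heckeMw (fsubset_refl _) (msuppD_le u1 u2)).
rewrite (heckeMw (fsubset_refl (msupp v)) (fsubsetUl (msupp u1) (msupp u2))).
rewrite (heckeMw (fsubset_refl (msupp v)) (fsubsetUr (msupp u1) (msupp u2))).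
rewrite -big_split /=; apply: eq_bigr => g _.
rewrite -big_split /=; apply: eq_bigr => h _.
by rewrite [mcoeff h _]mcoeffD mulrDr heckeUD.
Qed.

Lemma heckeM0l : left_zero 0 heckeM.
Proof. by move=> u; rewrite heckeM.unlock msupp0 big_seq_fset0. Qed.

Lemma heckeM0r : right_zero 0 heckeM.
Proof.
by move=> u; rewrite heckeM.unlock msupp0 big1 // => g _; rewrite big_seq_fset0.
Qed.

Lemma heckeMUU c d g h :
  heckeM (heckeU c g) (heckeU d h) = heckeU (c * d) (pmxM g h).
Proof.
rewrite heckeU.unlock (heckeMw msuppU_le msuppU_le) heckeU.unlock;
by rewrite !big_seq_fset1 !mcoeffUU.
Qed.

Lemma heckeM_suml (I : Type) (r : seq I) (F : I -> hecke_ring) v :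
  heckeM (\sum_(i <- r) F i) v = \sum_(i <- r) heckeM (F i) v.
Proof.
exact: (big_morph (heckeM^~ v) (fun x y => heckeMDl x y v) (heckeM0l v)).
Qed.

Lemma heckeM_sumr (I : Type) (r : seq I) (F : I -> hecke_ring) v :
  heckeM v (\sum_(i <- r) F i) = \sum_(i <- r) heckeM v (F i).
Proof. exact: (big_morph (heckeM v) (heckeMDr v) (heckeM0r v)). Qed.

Lemma heckeMA : associative heckeM.
Proof.
move=> u v w; rewrite [u]heckeE [v]heckeE [w]heckeE !heckeM_suml.
apply: eq_bigr => g _; rewrite [LHS]heckeM_sumr.
rewrite [in RHS](heckeM_sumr _ _ (heckeU _ g)) heckeM_suml.
apply: eq_bigr => h _.
rewrite (heckeM_sumr _ _ (heckeU _ h)) heckeM_sumr [RHS]heckeM_sumr.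
apply: eq_bigr => k _.
by rewrite (heckeMUU _ _ h k) (heckeMUU _ _ g h) (heckeMUU _ _ g)
  (heckeMUU _ _ _ k) mulrA pmxMA.
Qed.

Lemma heckeM1l : left_id hecke1 heckeM.
Proof.
move=> u; rewrite [u]heckeE heckeM_sumr; apply: eq_bigr => g _.
by rewrite heckeMUU mul1r pmx1M.
Qed.

Lemma heckeM1r : right_id hecke1 heckeM.
Proof.
move=> u; rewrite [u]heckeE heckeM_suml; apply: eq_bigr => g _.
by rewrite heckeMUU mulr1 pmxM1.
Qed.

Lemma hecke1_neq0 : hecke1 != 0.
Proof. by rewrite /hecke1 heckeU.unlock monalgU_eq0 oner_eq0. Qed.

End HeckeRing.

HB.instance Definition _ := GRing.Zmodule_isNzRing.Build hecke_ring
  heckeMA heckeM1l heckeM1r heckeMDl heckeMDr hecke1_neq0.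

(* [insubd] returns the identity when the matrix has determinant <= 0; it is
   only used below on matrices of positive determinant. *)
Definition cls (a b c d : int) : hecke_ring :=
  heckeU 1 (\pi_pmx (insubd posmx1 (mx22 a b c d))).

Definition Tmx : hecke_ring := cls 1 1 0 1.
Definition Smx : hecke_ring := cls 0 (- 1) 1 0.

Definition Tinf (n : nat) : hecke_ring :=
  \sum_(d <- divisors n) \sum_(b < d) cls (n %/ d)%N b 0 d.

(* u belongs to R_n = Q[M_n]. *)
Definition hecke_deg (n : nat) (u : hecke_ring) : Prop :=
  forall g, g \in msupp u -> pmx_det g = n.

Definition acts_like_Hecke (n : nat) (Tn : hecke_ring) : Prop :=
  exists2 Y : hecke_ring, hecke_deg n Y &
    (1 - Smx) * Tn = Tinf n * (1 - Smx) + (1 - Tmx) * Y.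

Definition nonneg_mx (A : 'M[int]_2) : bool := [forall i, forall j, 0 <= A i j].

Definition nonneg_elt (u : hecke_ring) : Prop :=
  forall g, g \in msupp u -> exists2 A : posmx, nonneg_mx (val A) & g = \pi_pmx A.

(* The unique matrix with non-negative entries in the class g, when there is
   one; slash below is therefore only meaningful on u with nonneg_elt u. *)
Definition nonneg_repr (g : pmx) : 'M[int]_2 :=
  if nonneg_mx (val (repr g)) then val (repr g) else - val (repr g).

Section Slash.
Variable R : realType.

(* x ^ w with the real logarithm, for x > 0: the value at x <= 0 is junk. *)
Definition cpow (x : R) (w : R[i]) : R[i] :=
  (expR (complex.Re w * ln x))%:C *
  (cos (complex.Im w * ln x) +i* sin (complex.Im w * ln x)).

Definition slash_mx (m : R[i]) (f : R -> R[i]) (A : 'M[int]_2) (x : R) : R[i] :=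
  let a := (A 0 0)%:~R in let b := (A 0 1)%:~R in
  let c := (A 1 0)%:~R in let d := (A 1 1)%:~R in
  cpow (a * d - b * c) (m / 2) / cpow (c * x + d) m * f ((a * x + b) / (c * x + d)).

Definition slash (m : R[i]) (f : R -> R[i]) (u : hecke_ring) (x : R) : R[i] :=
  \sum_(g <- msupp u) ratr (mcoeff g u) * slash_mx m f (nonneg_repr g) x.

Definition sigma (w : R[i]) (n : nat) : R[i] := \sum_(l <- divisors n) cpow l%:R w.

Definition psi_minus (s : R[i]) (x : R) : R[i] := 1 - cpow x (- (2 * s)).

End Slash.

(* Main.v *)
(** Sending a matrix to its bottom row [(c, d)] up to sign kills [(1 - T) Y],
    because left multiplication by [T] fixes the bottom row, while left
    multiplication by [S] moves the top row to the bottom. Apply to the relation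
    between [Tn] and [Tinf n] the linear functional sending a class with bottom
    row [(c, d)] to [|c x + d| ^ (-2s)]: the left-hand side becomes the sum of
    the [v_g ((c x + d) ^ (-2s) - (a x + b) ^ (-2s))], which is [n ^ (-s)] times
    the slash action on [psi_minus s], and the right-hand side becomes the sum
    over [d] dividing [n] of [d (d ^ (-2s) - (d x) ^ (-2s))]. *)
Require Import Defs.
From mathcomp Require Import all_boot all_order all_algebra finmap.
From mathcomp.multinomials Require Import monalg.
From mathcomp Require Import complex reals.
From mathcomp.analysis Require Import exp trigo.
From mathcomp Require Import ring.
Import Order.TTheory GRing.Theory Num.Theory.
Local Open Scope ring_scope.
Local Open Scope quotient_scope.
Local Open Scope complex_scope.

Section ComplexPower.
Variable R : realType.
Implicit Types (x y : R) (v w : R[i]).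

(** The addition law of the complex exponential, checked on real and imaginary parts with the
    addition formulas of [cos] and [sin]. *)
Lemma cpowD x v w : cpow x (v + w) = cpow x v * cpow x w.
Proof.
case: v w => [a b] [c d]; rewrite /cpow /= !mulrDl expRD cosD sinD.
by apply/eqP; rewrite eq_complex /=; apply/andP; split; apply/eqP; ring.
Qed.

Lemma cpowM x y w : 0 < x -> 0 < y -> cpow (x * y) w = cpow x w * cpow y w.
Proof.
move=> x0 y0; rewrite /cpow lnM ?posrE // !mulrDr expRD cosD sinD.
by apply/eqP; rewrite eq_complex /=; apply/andP; split; apply/eqP; ring.
Qed.

Lemma cpow0 x : cpow x 0 = 1.
Proof.
rewrite /cpow /= !mul0r expR0 cos0 sin0.
by apply/eqP; rewrite eq_complex /=; apply/andP; split; apply/eqP; ring.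
Qed.

Lemma cpow1l w : cpow 1 w = 1 :> R[i].
Proof.
rewrite /cpow ln1 !mulr0 expR0 cos0 sin0.
by apply/eqP; rewrite eq_complex /=; apply/andP; split; apply/eqP; ring.
Qed.

Lemma cpow1r x : 0 < x -> cpow x 1 = x%:C.
Proof.
move=> x0; rewrite /cpow /= mul0r mul1r cos0 sin0 lnK ?posrE //.
by apply/eqP; rewrite eq_complex /=; apply/andP; split; apply/eqP; ring.
Qed.

Lemma cpowN x w : cpow x (- w) = (cpow x w)^-1.
Proof.
have h : cpow x w * cpow x (- w) = 1 by rewrite -cpowD subrr cpow0.
have h0 : cpow x w != 0.
  by apply: contra_eqN h => /eqP ->; rewrite mul0r eq_sym oner_eq0.
by apply: (mulfI h0); rewrite h mulfV.
Qed.

Lemma cpow_neq0 x w : cpow x w != 0.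
Proof.
by rewrite -invr_eq0 -cpowN; apply/eqP => h; have := cpow0 x;
  rewrite -(subrr w) cpowD h mulr0 => /eqP; rewrite eq_sym oner_eq0.
Qed.

Lemma cpowV x w : 0 < x -> cpow x^-1 w = (cpow x w)^-1.
Proof.
move=> x0; apply: (mulfI (cpow_neq0 x w)).
by rewrite -cpowM ?invr_gt0 // !mulfV ?cpow_neq0 ?gt_eqF // cpow1l.
Qed.

End ComplexPower.

Section LinearExtension.
Variable K : numFieldType.
Implicit Types (f : pmx -> K) (u v : hecke_ring).

(** It has the same shape as [slash], so the two can be compared class by class at the end. *)
Definition hecke_lift f u : K := \sum_(g <- msupp u) ratr (mcoeff g u) * f g.

(** Coefficients vanish outside the support; a common [D] then allows sums over different supports
    to be added. *)
Lemma hecke_liftw f (D : {fset pmx}) u : (msupp u `<=` D)%fset ->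
  hecke_lift f u = \sum_(g <- D) ratr (mcoeff g u) * f g.
Proof.
move=> sub; apply: big_fset_incl => // g _ /mcoeff_outdom ->.
by rewrite rmorph0 mul0r.
Qed.

Lemma hecke_liftD f : {morph hecke_lift f : u v / u + v}.
Proof.
move=> u v; rewrite (hecke_liftw _ _ _ (msuppD_le u v)).
rewrite (hecke_liftw _ _ _ (fsubsetUl (msupp u) (msupp v))).
rewrite (hecke_liftw _ _ _ (fsubsetUr (msupp u) (msupp v))).
rewrite -big_split; apply: eq_bigr => g _.
by rewrite [mcoeff g _]mcoeffD rmorphD mulrDl.
Qed.

Lemma hecke_lift0 f : hecke_lift f 0 = 0.
Proof. by rewrite /hecke_lift msupp0 big_seq_fset0. Qed.

Lemma hecke_liftB f : {morph hecke_lift f : u v / u - v}.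
Proof.
by move=> u v; apply/eqP; rewrite eq_sym subr_eq -hecke_liftD subrK.
Qed.

Lemma hecke_lift_sum f (I : Type) (r : seq I) (F : I -> hecke_ring) :
  hecke_lift f (\sum_(i <- r) F i) = \sum_(i <- r) hecke_lift f (F i).
Proof. exact: (big_morph _ (hecke_liftD f) (hecke_lift0 f)). Qed.

Lemma hecke_liftU f c g : hecke_lift f (heckeU c g) = ratr c * f g.
Proof.
by rewrite heckeU.unlock (hecke_liftw _ _ _ msuppU_le) big_seq_fset1 mcoeffUU.
Qed.

(** Reduces left multiplication by [S] or [T] in the ring to its effect on single classes. *)
Lemma hecke_liftUM f g u :
  hecke_lift f (heckeU 1 g * u) = hecke_lift (f \o pmxM g) u.
Proof.
rewrite [u in LHS]heckeE [LHS](congr1 _ (heckeM_sumr _ _ _)) hecke_lift_sum.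
by apply: eq_bigr => h _; rewrite heckeMUU mul1r hecke_liftU.
Qed.

End LinearExtension.

Lemma det_mx2 (K : comNzRingType) (A : 'M[K]_2) :
  \det A = A 0 0 * A 1 1 - A 0 1 * A 1 0.
Proof.
rewrite (expand_det_row _ 0) !big_ord_recl big_ord0 addr0 /cofactor !det_mx11.
rewrite !mxE /= expr0 expr1 mul1r mulN1r mulrN.
by congr (_ * _ - _ * _); congr (fun_of_matrix A _ _); apply: val_inj.
Qed.

Section BottomRow.
Variables (R : realType) (w : R[i]) (x : R).

(** The absolute value makes the result independent of the sign of the representative. *)
Definition bottom_row_pow (g : pmx) : R[i] :=
  cpow `|(val (repr g) 1 0)%:~R * x + (val (repr g) 1 1)%:~R| w.

Lemma bottom_row_powE (A : posmx) :
  bottom_row_pow (\pi_pmx A) = cpow `|(val A 1 0)%:~R * x + (val A 1 1)%:~R| w.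
Proof.
rewrite /bottom_row_pow; case: (repr_pmx A) => -> //.
by rewrite !mxE !rmorphN mulNr -opprD normrN.
Qed.

(** A positive determinant excludes the default value of [insubd], so [cls] denotes the intended
    class. *)
Lemma val_insubd_mx22 (a b c d : int) : 0 < a * d - b * c ->
  val (insubd posmx1 (mx22 a b c d)) = mx22 a b c d.
Proof. by move=> h; rewrite insubdK // unfold_in det_mx2 !mxE. Qed.

Lemma mulmx22_bottom (a b c d : int) (A : 'M[int]_2) j :
  (mx22 a b c d *m A) 1 j = c * A 0 j + d * A 1 j.
Proof.
rewrite mxE !big_ord_recl big_ord0 addr0 !mxE /=.
by congr (_ + d * fun_of_matrix A _ _); apply: val_inj.
Qed.

Lemma bottom_row_powMT (g : pmx) :
  bottom_row_pow (pmxM (\pi_pmx (insubd posmx1 (mx22 1 1 0 1))) g)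
  = bottom_row_pow g.
Proof.
elim/quotW: g => A; rewrite pmxME !bottom_row_powE /= val_insubd_mx22 //.
by rewrite !mulmx22_bottom !mul0r !mul1r !add0r.
Qed.

Lemma hecke_lift_bottom_rowMT (u : hecke_ring) :
  hecke_lift _ bottom_row_pow (Tmx * u) = hecke_lift _ bottom_row_pow u.
Proof.
by rewrite hecke_liftUM; apply: eq_bigr => g _; rewrite /= bottom_row_powMT.
Qed.

Lemma bottom_row_powMS (A : posmx) :
  bottom_row_pow (pmxM (\pi_pmx (insubd posmx1 (mx22 0 (-1) 1 0))) (\pi_pmx A))
  = cpow `|(val A 0 0)%:~R * x + (val A 0 1)%:~R| w.
Proof.
rewrite pmxME !bottom_row_powE /= val_insubd_mx22 //.
by rewrite !mulmx22_bottom !mul0r !mul1r !addr0.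
Qed.

End BottomRow.

(** If both [A] and [- A] had non-negative entries, [A] would be zero, against its positive
    determinant. *)
Lemma nonneg_reprE (A : posmx) :
  nonneg_mx (val A) -> nonneg_repr (\pi_pmx A) = val A.
Proof.
move=> A0; rewrite /nonneg_repr.
case: (repr_pmx A) => ->; rewrite ?A0 ?opprK //; case: ifP => // NA0.
have /matrixP A_0 : val A = 0.
  apply/matrixP => i j; rewrite mxE; apply/le_anti.
  rewrite (forallP (forallP A0 i) j) -oppr_ge0 andbT.
  by have := forallP (forallP NA0 i) j; rewrite mxE.
by have := valP A; rewrite /= det_mx2 !A_0 !mxE !mul0r subrr ltxx.
Qed.

Section SlashPsi.
Variables (R : realType) (s : R[i]) (x : R) (hx : 0 < x).

Local Notation F := (bottom_row_pow R (- (2 * s)) x).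
Local Notation Sg := (\pi_pmx (insubd posmx1 (mx22 0 (-1) 1 0))).

(** The factor [(c x + d) ^ (-2s)] of the slash action clears the denominator of
    [((a x + b) / (c x + d)) ^ (-2s)]. *)
Lemma slash_psi_minusE (n : nat) (g : pmx) (A : posmx) : nonneg_mx (val A) ->
  g = \pi_pmx A -> pmx_det g = n ->
  slash_mx (2 * s) (psi_minus s) (nonneg_repr g) x
  = cpow n%:R s * (F g - F (pmxM Sg g)).
Proof.
move=> A0 ->; rewrite pmx_detE nonneg_reprE // bottom_row_powMS bottom_row_powE.
have := valP A; rewrite /= det_mx2.
have Age0 i j : 0 <= val A i j by apply: (forallP (forallP A0 i) j).
have lin_gt0 (i : 'I_2) : (val A i 0 != 0) || (val A i 1 != 0) ->
    0 < (val A i 0)%:~R * x + (val A i 1)%:~R.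
  case/orP=> nz.
    by rewrite ltr_pwDl ?ler0z ?mulr_gt0 ?ltr0z // lt0r nz Age0.
  by rewrite ltr_wpDl ?mulr_ge0 ?ler0z ?(ltW hx) // ltr0z lt0r nz Age0.
move=> det_gt0 det_n; rewrite /slash_mx.
(* A zero row would make the determinant vanish. *)
have bot_gt0 : 0 < (val A 1 0)%:~R * x + (val A 1 1)%:~R.
  apply: lin_gt0; rewrite -negb_and; apply: contraTN det_gt0.
  by case/andP=> /eqP -> /eqP ->; rewrite !mulr0 subrr ltxx.
have top_gt0 : 0 < (val A 0 0)%:~R * x + (val A 0 1)%:~R.
  apply: lin_gt0; rewrite -negb_and; apply: contraTN det_gt0.
  by case/andP=> /eqP -> /eqP ->; rewrite !mul0r subrr ltxx.
rewrite -!intrM -intrB det_n !gtr0_norm // /psi_minus.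
rewrite cpowM ?invr_gt0 // cpowV // !cpowN invrK.
have -> : 2 * s / 2 = s by field.
by rewrite -mulrA mulrBr mulr1 mulrCA mulVf ?cpow_neq0 // mulr1.
Qed.

(** Right multiplication by [S] changes the bottom row [(0, d)] into [(d, 0)], so each matrix
    contributes [d ^ (-2s) - (d x) ^ (-2s)]. *)
Lemma hecke_lift_Tinf (n : nat) : (0 < n)%N ->
  hecke_lift _ F (Tinf n * (1 - Smx))
  = sigma (1 - 2 * s) n * psi_minus s x.
Proof.
move=> n0; rewrite mulrBr mulr1 hecke_liftB /Tinf.
rewrite [(\sum_(d <- _) _) * _]heckeM_suml !hecke_lift_sum -sumrB /sigma mulr_suml.
apply: eq_big_seq => d; rewrite -dvdn_divisors // => dn.
have d0 : (0 < d)%N := dvdn_gt0 n0 dn.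
have nd0 : (0 < n %/ d)%N by rewrite divn_gt0 // dvdn_leq.
rewrite heckeM_suml !hecke_lift_sum -sumrB.
have dR : 0 < d%:R :> R by rewrite ltr0n.
(* The term does not depend on [b]; the [d] choices of [b] raise the exponent from [-2s] to
   [1 - 2s]. *)
rewrite (eq_bigr (fun=> cpow d%:R (- (2 * s)) * psi_minus s x)) => [|b _].
  rewrite sumr_const card_ord -mulrnAl cpowD cpow1r // -mulr_natl.
  by rewrite (rmorph_nat (real_complex R)).
have det_gt0 : 0 < (n %/ d)%N%:Z * d - b%:Z * 0.
  by rewrite mulr0 subr0 -PoszM ltz_nat muln_gt0 nd0.
rewrite /cls /Smx /cls heckeMUU pmxME !hecke_liftU !bottom_row_powE.
rewrite /= !val_insubd_mx22 // !mulmx22_bottom !mxE /=.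
rewrite !(mul0r, mulr0, mul1r, mulr1, add0r, addr0, rmorph1).
rewrite !normrM !normr_nat gtr0_norm // cpowM //.
by rewrite /psi_minus mulrBr mulr1.
Qed.

End SlashPsi.

Theorem theorem1p2 (R : realType) (n : nat) (hn : (0 < n)%N)
    (Tn : hecke_ring) (hdeg : hecke_deg n Tn) (hT : acts_like_Hecke n Tn)
    (hpos : nonneg_elt Tn) (s : R[i]) (hs : 0 < complex.Re s) (x : R) (hx : 0 < x) :
  slash (2 * s) (psi_minus s) Tn x
    = cpow n%:R s * sigma (1 - 2 * s) n * psi_minus s x.
Proof.
case: hT => Y _ /(congr1 (hecke_lift _ (bottom_row_pow R (- (2 * s)) x))).
rewrite hecke_liftD hecke_lift_Tinf // !mulrBl !mul1r !hecke_liftB.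
rewrite hecke_lift_bottom_rowMT subrr addr0 /Smx /cls hecke_liftUM -mulrA => <-.
(* Both sides are now sums over the support of [Tn], where [hpos] and [hdeg] supply a non-negative
   representative of determinant [n]. *)
rewrite /hecke_lift -sumrB mulr_sumr; apply: eq_big_seq => g gTn.
have [A A0 gA] := hpos g gTn.
by rewrite (slash_psi_minusE R s x hx n g A A0 gA (hdeg g gTn)) -mulrBr mulrCA.
Qed.
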